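(* In the setting of a two-terminal substress $\mathcal H$ (see context), let $|I|=5$, with internal vertices ordered $1,\dots,5$, and let $C$ be the internal $5\times5$ skew block of $B_{\mathcal H}$ and $E$ the $2\times5$ terminal–internal block. Define $$\kappa_i=(-1)^{i-1}\operatorname{Pf}(C_{\widehat i}),\qquad i=1,\dots,5,$$ where $C_{\widehat i}$ is obtained from $C$ by deleting row and column $i$. Then $C\kappa=0$. If $\operatorname{rank}C=4$, then $\ker C=\langle\kappa\rangle$, and every nonzero flux has the following form: whenever $\xi\in K_{\mathrm{sh}}(P)$ satisfies $(B_{\mathcal H}\xi)_i=0$ for all $i\in I$ and $B_{\mathcal H}\xi=\rho(e_a-e_b)$ with $\rho\ne0$ (so that $\xi_a=\xi_b=:c$), then, with $w=\xi-c\mathbf 1$, there is $\tau\in\mathbb R$ with $$w_I=\tau\kappa,\qquad \rho\,(1,-1)^T=\tau E\kappa .$$ Moreover the resulting port flux $E\kappa$ is given by a homogeneous cubic polynomial in the signed row weights $s_t\lambda_t$, $t\in\mathcal H$ (each coordinate of $E\kappa$ is a homogeneous polynomial of degree $3$ in these weights).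
   Context: A configuration is $P=(p_1,\dots,p_n)$, $n\ge3$, with $p_i=(x_i,y_i)\in[0,1]^2$. For a triple $t=(i,j,k)$, $i<j<k$, put $D_t(P)=\det(p_j-p_i,p_k-p_i)$, $A_t(P)=\tfrac12|D_t(P)|$, and $\delta(P)=\min_tA_t(P)$. A positive-area local optimum is a local maximizer $P$ of $\delta$ on $([0,1]^2)^n$ with $\Delta:=\delta(P)>0$. Put $s_t=\operatorname{sgn}D_t(P)$; near $P$, $A_t=\tfrac12s_tD_t$, which is used for derivatives. A normalized KKT multiplier at $P$ is a tuple $q=(\lambda,\ell,r,d,u)$ of nonnegative reals $\lambda_t$ (all triples $t$), $\ell_i,r_i,d_i,u_i$ ($i\in[n]$) with: $\lambda_t=0$ unless $A_t(P)=\Delta$; $\ell_i=0$ unless $x_i=0$, $r_i=0$ unless $x_i=1$, $d_i=0$ unless $y_i=0$, $u_i=0$ unless $y_i=1$; $\sum_t\lambda_t=1$; and $\sum_t\lambda_t\nabla_{p_i}A_t(P)+(\ell_i-r_i,d_i-u_i)=0$ for all $i$. Their set is $\mathcal K(P)$. For $t=(i,j,k)$, $i<j<k$, let $B_t=s_t(a_tc_t^T-c_ta_t^T)\in\mathbb R^{n\times n}$, $a_t=e_j-e_i$, $c_t=e_k-e_i$, and $B(q)=\sum_t\lambda_tB_t$. The shared kernel is $K_{\mathrm{sh}}(P)=\bigcap_{q\in\mathcal K(P)}\ker B(q)$. Two-terminal substress: fix a positive-area local optimum $P$, a normalized KKT multiplier with triangle part $\lambda$, and a nonempty family $\mathcal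 H$ of triangles $t$ with $\lambda_t>0$, with vertex set partitioned as $V(\mathcal H)=I\sqcup\{a,b\}$, $a\neq b$ ($I$ internal vertices, $a,b$ terminals). Put $B_{\mathcal H}=\sum_{t\in\mathcal H}\lambda_tB_t$. Restricting $B_{\mathcal H}$ to $V(\mathcal H)$ with the terminals $a,b$ ordered first, write $$B_{\mathcal H}=\begin{pmatrix}A&E\\-E^T&C\end{pmatrix},$$ with $C$ the skew block on $I$. If $\xi\in K_{\mathrm{sh}}(P)$ satisfies $(B_{\mathcal H}\xi)_i=0$ for $i\in I$, then $B_{\mathcal H}\xi=\rho(e_a-e_b)$ for a scalar $\rho$, called the flux, and $\rho(\xi_a-\xi_b)=0$. $w_I$ denotes the restriction of $w$ to $I$, $\mathbf 1$ the all-ones vector, $\operatorname{Pf}$ the Pfaffian. *)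

(* Defs.v *)
From mathcomp Require Import all_boot all_order all_algebra all_fingroup.
From mathcomp Require Import reals.
From mathcomp Require mpoly.

Set Implicit Arguments.
Unset Strict Implicit.
Unset Printing Implicit Defensive.

(* mpoly is only imported inside this module: its notations clash with those
   of mathcomp-analysis. *)
Module MPolyDefs.
Import mpoly.
Definition homogeneous_of_degree (R : realType) (N d : nat)
  (p : {mpoly R[N]}) : bool := p \is d.-homog.
End MPolyDefs.

From mathcomp Require Import all_classical all_reals all_analysis.
Export MPolyDefs.

Import Order.TTheory GRing.Theory Num.Theory.
Import numFieldNormedType.Exports.

Local Open Scope classical_set_scope.
Local Open Scope ring_scope.

Notation triple n :=
  {t : 'I_n * 'I_n * 'I_n | (t.1.1 < t.1.2 < t.2)%N}.

Definition vtx1 n (t : triple n) : 'I_n := (val t).1.1.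
Definition vtx2 n (t : triple n) : 'I_n := (val t).1.2.
Definition vtx3 n (t : triple n) : 'I_n := (val t).2.

(* A configuration is the 2 x n matrix whose i-th column is the point p_i:
   x_i = P 0 i and y_i = P 1 i. *)
Notation configuration R n := 'M[R]_(2, n) (only parsing).

Definition in_box (R : realType) n : set (configuration R n) :=
  [set P | forall k i, 0 <= P k i <= 1].

Definition Dt (R : realType) n (P : configuration R n) (t : triple n) : R :=
  \det (row_mx (col (vtx2 t) P - col (vtx1 t) P)
               (col (vtx3 t) P - col (vtx1 t) P) : 'M[R]_2).

Definition At (R : realType) n (P : configuration R n) (t : triple n) : R :=
  2^-1 * `|Dt P t|.

Definition sgnD (R : realType) n (P : configuration R n) (t : triple n) : R :=
  Num.sg (Dt P t).

(* For n >= 3 the set of areas is finite and nonempty, so that its infimum is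
   its minimum. *)
Definition delta (R : realType) n (P : configuration R n) : R :=
  inf [set At P t | t in [set: triple n]].

Definition positive_area_local_optimum (R : realType) n
    (P : configuration R n) : Prop :=
  [/\ in_box P,
      \forall Q \near P, in_box Q -> delta Q <= delta P
    & 0 < delta P].

(* The gradient of A_t at P with respect to p_i, computed from the local
   expression (s_t / 2) D_t with s_t frozen at P. *)
Definition grad_area (R : realType) n (P : configuration R n) (t : triple n)
    (i : 'I_n) : 'cV[R]_2 :=
  \col_k derive1
    (fun h : R => 2^-1 * sgnD P t * Dt (P + h *: delta_mx k i) t) 0.

Record multiplier (R : realType) (n : nat) := Multiplier {
  lam : triple n -> R;
  mleft : 'I_n -> R;
  mright : 'I_n -> R;
  mdown : 'I_n -> R;
  mup : 'I_n -> R }.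

Record is_KKT (R : realType) n (P : configuration R n) (q : multiplier R n) :
    Prop := IsKKT {
  lam_ge0 : forall t, 0 <= lam q t;
  mleft_ge0 : forall i, 0 <= mleft q i;
  mright_ge0 : forall i, 0 <= mright q i;
  mdown_ge0 : forall i, 0 <= mdown q i;
  mup_ge0 : forall i, 0 <= mup q i;
  lam_slack : forall t, At P t != delta P -> lam q t = 0;
  mleft_slack : forall i, P 0 i != 0 -> mleft q i = 0;
  mright_slack : forall i, P 0 i != 1 -> mright q i = 0;
  mdown_slack : forall i, P 1 i != 0 -> mdown q i = 0;
  mup_slack : forall i, P 1 i != 1 -> mup q i = 0;
  lam_sum1 : \sum_t lam q t = 1;
  stationary : forall i,
    \sum_t lam q t *: grad_area P t i
    + \col_k [:: mleft q i - mright q i; mdown q i - mup q i]`_k = 0 }.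

Definition KKT (R : realType) n (P : configuration R n) :
  set (multiplier R n) := [set q | is_KKT P q].

Definition evec (R : realType) n (i : 'I_n) : 'cV[R]_n := delta_mx i 0.

Definition Bt (R : realType) n (P : configuration R n) (t : triple n) :
    'M[R]_n :=
  let a := evec R (vtx2 t) - evec R (vtx1 t) in
  let c := evec R (vtx3 t) - evec R (vtx1 t) in
  sgnD P t *: (a *m c^T - c *m a^T).

Definition B (R : realType) n (P : configuration R n) (l : triple n -> R) :
  'M[R]_n := \sum_t l t *: Bt P t.

Definition shared_kernel (R : realType) n (P : configuration R n) :
    set 'cV[R]_n :=
  \bigcap_(q in KKT P) [set xi | B P (lam q) *m xi = 0].

Definition vertices n (H : {set triple n}) : {set 'I_n} :=
  (\bigcup_(t in H) [set vtx1 t; vtx2 t; vtx3 t])%SET.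

Definition two_terminal n (H : {set triple n}) (I : {set 'I_n}) (a b : 'I_n) :
    Prop :=
  [/\ H != finset.set0, vertices H = (I :|: [set a; b])%SET,
      (I :&: [set a; b])%SET = finset.set0 & a != b].

Definition BH (R : realType) n (P : configuration R n) (l : triple n -> R)
  (H : {set triple n}) : 'M[R]_n := \sum_(t in H) l t *: Bt P t.

(* v enumerates the internal vertices in the chosen order. *)
Definition internal_block (R : realType) n m (v : 'I_m -> 'I_n) (M : 'M[R]_n) :
  'M[R]_m := mxsub v v M.

Definition terminal_block (R : realType) n m (a b : 'I_n) (v : 'I_m -> 'I_n)
  (M : 'M[R]_n) : 'M[R]_(2, m) := mxsub (tnth [tuple a; b]) v M.

(* For i < 2m even, ordS i is i + 1, so that the product pairs s(2j) with
   s(2j + 1). *)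
Definition Pf (R : realType) (m : nat) (A : 'M[R]_(m.*2)) : R :=
  (2 ^+ m * (m`!)%:R)^-1 *
  \sum_(s : 'S_(m.*2))
    (-1) ^+ s * \prod_(i < m.*2 | ~~ odd i) A (s i) (s (ordS i)).

(* The index i starts at 0, hence the sign (-1)^i. *)
Definition pf_vector (R : realType) (C : 'M[R]_5) : 'cV[R]_5 :=
  \col_i ((-1) ^+ i * Pf (m := 2) (row' i (col' i C))).

Definition signed_weights (R : realType) n (P : configuration R n)
    (l : triple n -> R) (H : {set triple n}) : 'I_#|H| -> R :=
  fun j => sgnD P (enum_val j) * l (enum_val j).

Arguments signed_weights {R n} P l H _.

(* Main.v *)
(* Summing the flux equation against xi kills the skew form xi^T B_H xi, whence
   xi_a = xi_b.  As each B_t kills constant vectors and B_H lives on I + {a, b},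
   the shifted vector w vanishes at the terminals, so the rows of B_H w = B_H xi
   read C w_I = 0 and E w_I = rho (1, -1)^T.  The kernel of C is spanned by kappa
   as soon as kappa <> 0; and if all 4 x 4 sub-Pfaffians of C vanish, then the
   Pluecker relations make C a multiple of a sum of two products column * row,
   so that C has rank at most 2.  Finally B_H is linear in the signed weights,
   and E kappa is cubic in its entries. *)
Require Import Defs.
From mathcomp Require Import all_boot all_order all_algebra all_fingroup.
From mathcomp Require Import reals.
From mathcomp Require mpoly.
From mathcomp Require Import ring lra.
Import GRing.Theory.
Local Open Scope ring_scope.

Set Implicit Arguments.
Unset Strict Implicit.
Unset Printing Implicit Defensive.

(** * Homogeneous polynomial functions of the weights *)

Module Forms.
Import mpoly.
Section Forms.
Variables (R : realType) (N : nat).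

(** The polynomial is hidden behind the function it evaluates to, so the closure lemmas below
    assemble a homogeneous witness along with any expression in the weights. *)
Definition is_form d (F : ('I_N -> R) -> R) : Prop :=
  exists2 p : {mpoly R[N]}, p \is d.-homog & forall w, F w = p.@[w].

Lemma form_var i : is_form 1 (fun w => w i).
Proof.
exists 'X_i => [|w]; last by rewrite mevalXU.
by rewrite dhomogX /= mdeg1.
Qed.

Lemma formZ d c F : is_form d F -> is_form d (fun w => c * F w).
Proof.
by case=> p hp FE; exists (c *: p) => [|w]; rewrite ?dhomogZ // FE mevalZ.
Qed.

Lemma formD d F G :
  is_form d F -> is_form d G -> is_form d (fun w => F w + G w).
Proof.
case=> p hp FE [q hq GE]; exists (p + q) => [|w]; first exact: dhomogD.
by rewrite FE GE mevalD.
Qed.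

Lemma formB d F G :
  is_form d F -> is_form d G -> is_form d (fun w => F w - G w).
Proof.
case=> p hp FE [q hq GE]; exists (p - q) => [|w]; first exact: rpredB.
by rewrite FE GE mevalB.
Qed.

Lemma formM d e F G :
  is_form d F -> is_form e G -> is_form (d + e) (fun w => F w * G w).
Proof.
case=> p hp FE [q hq GE]; exists (p * q) => [|w]; first exact: dhomogM.
by rewrite FE GE mevalM.
Qed.

Lemma form_sum d (J : finType) (F : J -> ('I_N -> R) -> R) :
  (forall j, is_form d (F j)) -> is_form d (fun w => \sum_j F j w).
Proof.
case/fin_all_exists2 => p hp FE; exists (\sum_j p j) => [|w].
  by apply: rpred_sum => j _.
by rewrite raddf_sum; apply: eq_bigr => j _.
Qed.

Lemma form_family d (J : finType) (F : J -> ('I_N -> R) -> R) :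
  (forall j, is_form d (F j)) ->
  exists p : J -> {mpoly R[N]},
    (forall j, homogeneous_of_degree d (p j)) /\
    (forall w j, F j w = (p j).@[w]).
Proof. by case/fin_all_exists2 => p hp FE; exists p; split. Qed.

End Forms.
End Forms.
Import Forms.

(** * Expansion of sums over permutations *)

Lemma big_lift_perm (V : nmodType) n (F : 'S_n.+1 -> V) :
  \sum_s F s = \sum_j \sum_(s : 'S_n) F (lift_perm ord0 j s).
Proof.
rewrite pair_bigA (reindex (fun u : 'I_n.+1 * 'S_n => lift_perm ord0 u.1 u.2)) //=.
(* The image of 0 and the induced permutation of the other points determine a permutation;
   bijectivity then follows from the count (n+1) n! = (n+1)!. *)
apply: onW_bij; apply: inj_card_bij => [[j s] [j' s'] /= eqs|].
  have eqj : j = j' by rewrite -(lift_perm_id ord0 j s) eqs lift_perm_id.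
  congr pair => //; apply/permP => k; apply: (@lift_inj _ j).
  by rewrite -(lift_perm_lift ord0 j s) eqs {1}eqj lift_perm_lift.
have card_S m : #|{: 'S_m}| = m`!.
  by rewrite -[RHS](card_Sn m); apply: eq_card => s; rewrite !inE.
by rewrite card_prod !card_S card_ord -factS.
Qed.

Lemma sum_S0 (V : nmodType) (F : 'S_0 -> V) : \sum_s F s = F 1%g.
Proof.
rewrite (bigD1 1%g) //= big1 ?addr0 // => s /eqP[].
by apply/permP => - [].
Qed.

(** * Skew matrices of order 4 and 5 and the Pfaffian vector *)

Section Skew.
Variable R : realType.

Lemma skewE m (A : 'M[R]_m) i j : A^T = - A -> A j i = - A i j.
Proof. by move/matrixP/(_ i j); rewrite !mxE. Qed.

(* With nat-indexed entries, concrete ordinals of different shapes (inord, lift)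
   normalise by computation. *)
Lemma skew_nat m (A : 'M[R]_m.+1) : A^T = - A ->
  exists c : nat -> nat -> R, forall i j : 'I_m.+1,
    A i j = if (i < j)%N then c i j else if (j < i)%N then - c j i else 0.
Proof.
move=> Ask; exists (fun i j => A (inord i) (inord j)) => i j.
rewrite !inord_val; case: (ltngtP i j) => [//|_|/val_inj ->]; first exact: skewE.
by have := skewE j j Ask; clear; lra.
Qed.

(** Four points have three perfect matchings; each comes from 8 = 2^2 2! permutations with equal
    signed products, and the normalising factor in [Pf] cancels this 8. *)
Lemma Pf4_skew (A : 'M[R]_4) : A^T = - A ->
  Pf (m := 2) A =
    A ord0 (inord 1) * A (inord 2) (inord 3)
    - A ord0 (inord 2) * A (inord 1) (inord 3)
    + A ord0 (inord 3) * A (inord 1) (inord 2).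
Proof.
case/skew_nat => c AE.
have prodE (s : 'S_4) : \prod_(i < 4 | ~~ odd i) A (s i) (s (ordS i)) =
    A (s ord0) (s (lift ord0 ord0)) *
    A (s (lift ord0 (lift ord0 ord0))) (s (lift ord0 (lift ord0 (lift ord0 ord0)))).
  rewrite big_mkcond !big_ord_recl big_ord0 /= !mul1r mulr1.
  by congr (A _ (s _) * A _ (s _)); apply: val_inj.
rewrite /Pf; under eq_bigr => s _ do rewrite prodE.
(* The images of the four points are fixed one after another, which leaves 24 explicit signed
   terms. *)
rewrite big_lift_perm; under eq_bigr => j _ do under eq_bigr => s _ do
  rewrite lift_perm_id !lift_perm_lift odd_lift_perm.
under eq_bigr => j _ do rewrite big_lift_perm.
under eq_bigr => j _ do under eq_bigr => j1 _ do under eq_bigr => s _ do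
  rewrite lift_perm_id !lift_perm_lift odd_lift_perm.
under eq_bigr => j _ do under eq_bigr => j1 _ do rewrite big_lift_perm.
under eq_bigr => j _ do under eq_bigr => j1 _ do under eq_bigr => j2 _ do
  under eq_bigr => s _ do rewrite lift_perm_id !lift_perm_lift odd_lift_perm.
under eq_bigr => j _ do under eq_bigr => j1 _ do under eq_bigr => j2 _ do
  (rewrite big_lift_perm; under eq_bigr => j3 _ do rewrite sum_S0).
rewrite !big_ord_recl !big_ord0.
rewrite !AE !lift_perm_id !odd_lift_perm !odd_perm1.
rewrite !inordK //=.
have -> : 2`! = 2%N by [].
by rewrite /bump /= !add1n !add0n ?expr0 ?expr1; field.
Qed.

Lemma skew_principal m (A : 'M[R]_m) i : A^T = - A ->
  (row' i (col' i A))^T = - row' i (col' i A).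
Proof.
move=> Ask; apply/matrixP => j k.
by have /matrixP/(_ (lift i j) (lift i k)) := Ask; rewrite !mxE.
Qed.

Lemma pf_vectorE (C : 'M[R]_5) i : C^T = - C ->
  pf_vector C i 0 = (-1) ^+ i *
    (C (lift i ord0) (lift i (inord 1)) * C (lift i (inord 2)) (lift i (inord 3))
     - C (lift i ord0) (lift i (inord 2)) * C (lift i (inord 1)) (lift i (inord 3))
     + C (lift i ord0) (lift i (inord 3)) * C (lift i (inord 1)) (lift i (inord 2))).
Proof. by move=> Csk; rewrite mxE (Pf4_skew (skew_principal i Csk)) !mxE. Qed.

(** Row [i] of the product expands the Pfaffian of the 6x6 skew matrix in which index [i] is
    repeated, so it vanishes; each row is checked as a polynomial identity in the entries above the
    diagonal. *)
Lemma mul_pf_vector (C : 'M[R]_5) : C^T = - C -> C *m pf_vector C = 0.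
Proof.
move=> Csk; have [c CE] := skew_nat Csk.
apply/colP => i; rewrite !mxE !big_ord_recl big_ord0 !pf_vectorE // !CE.
rewrite /= /bump /= !inordK //= !add1n /=.
case: i => [[|[|[|[|[|//]]]]] lti] /=; ring.
Qed.

(** For distinct indices the difference of the two sides is, up to sign, a coordinate of
    [pf_vector C]; if two indices coincide the identity is trivial. *)
Lemma pf_vector_eq0_pluecker (C : 'M[R]_5) i j k l :
  C^T = - C -> pf_vector C = 0 ->
  C i j * C k l = C i k * C j l - C i l * C j k.
Proof.
move=> Csk kap0.
(* Both sides change sign when [i] and [j] are swapped, and vanish when they agree; the same holds
   for [k] and [l]. *)
wlog ltij : i j / (i < j)%N.
  move=> lt_case; case: (ltngtP i j) => [/lt_case //|/lt_case|/val_inj <-].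
    by rewrite (skewE j i Csk) mulNr => ->; ring.
  have -> : C i i = 0 by have := skewE i i Csk; clear; lra.
  ring.
wlog ltkl : k l / (k < l)%N.
  move=> lt_case; case: (ltngtP k l) => [/lt_case //|/lt_case|/val_inj <-].
    by rewrite (skewE l k Csk) mulrN => ->; ring.
  have -> : C k k = 0 by have := skewE k k Csk; clear; lra.
  ring.
have [c CE] := skew_nat Csk; move/colP: kap0 => kap0.
have := (kap0 ord0, kap0 (inord 1), kap0 (inord 2), kap0 (inord 3), kap0 (inord 4)).
rewrite !pf_vectorE // !CE !mxE /= /bump /= !inordK //= !add1n !add0n /=.
case=> [[[[E0 E1] E2] E3] E4]; clear -E0 E1 E2 E3 E4 ltij ltkl.
case: j ltij => [[|[|[|[|[|//]]]]] ltj] /=;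
case: i => [[|[|[|[|[|//]]]]] lti] //= _;
case: l ltkl => [[|[|[|[|[|//]]]]] ltl] /=;
case: k => [[|[|[|[|[|//]]]]] ltk] //= _;
clear -E0 E1 E2 E3 E4; lra.
Qed.

Lemma pf_vector_neq0 (C : 'M[R]_5) :
  C^T = - C -> \rank C = 4%N -> pf_vector C != 0.
Proof.
move=> Csk rankC; apply/eqP => kap0.
have /matrix0Pn[i [j Cij]] : C != 0.
  by apply/eqP => C0; rewrite C0 mxrank0 in rankC.
(* Dividing the Pluecker relation by the pivot [C i j] expresses every [C k l] through rows [i] and
   [j]; [U] collects the coefficients. *)
pose U := (C i j)^-1 *: row_mx (col j C) (- col i C).
have CE : C = U *m col_mx (row i C) (row j C).
  apply/matrixP => k l; rewrite -scalemxAl mul_row_col !mxE !big_ord1 !mxE.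
  have := pf_vector_eq0_pluecker i j k l Csk kap0.
  move=> Ekl; apply: (mulfI Cij).
  by rewrite mulrA divff // mul1r Ekl (skewE k i Csk) (skewE k j Csk); ring.
have := leq_trans (mxrankM_maxr U _) (rank_leq_row (col_mx (row i C) (row j C))).
by rewrite -CE rankC.
Qed.

Lemma kernel_pf_vector (C : 'M[R]_5) (x : 'cV[R]_5) :
  C^T = - C -> \rank C = 4%N ->
  C *m x = 0 <-> exists tau : R, x = tau *: pf_vector C.
Proof.
move=> Csk rankC; split=> [Cx0|[tau ->]]; last first.
  by rewrite -scalemxAr mul_pf_vector ?scaler0.
(* [kermx] is a space of row vectors, hence the transposes. Its dimension here is 5 - 4 = 1, so the
   nonzero Pfaffian vector spans it. *)
have in_ker (y : 'cV_5) : C *m y = 0 -> (y^T <= kermx C^T)%MS.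
  by move=> Cy0; apply/sub_kermxP; rewrite -trmx_mul Cy0 trmx0.
have kap_ker := in_ker _ (mul_pf_vector Csk).
have rank_kap : \rank (pf_vector C)^T = 1%N.
  by rewrite rank_rV -trmx0 (inj_eq trmx_inj) pf_vector_neq0.
have ker_kap : (kermx C^T <= (pf_vector C)^T)%MS.
  by rewrite -(mxrank_leqif_sup kap_ker) rank_kap mxrank_ker mxrank_tr rankC.
have /sub_rVP[tau xE] := submx_trans (in_ker _ Cx0) ker_kap.
by exists tau; apply: trmx_inj; rewrite xE linearZ.
Qed.
End Skew.

(** * The substress matrix as a function of the signed weights *)

Section Substress.
Variables (R : realType) (n : nat).
Implicit Types (H : {set triple n}) (P : 'M[R]_(2, n)) (l : triple n -> R).

Definition unsigned_Bt (t : triple n) : 'M[R]_n :=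
  let a := evec R (vtx2 t) - evec R (vtx1 t) in
  let c := evec R (vtx3 t) - evec R (vtx1 t) in
  a *m c^T - c *m a^T.

(** With the signs moved into [w], the configuration enters only through the weights, so one
    polynomial can serve all configurations. *)
Definition weighted_BH H (w : 'I_#|H| -> R) : 'M[R]_n :=
  \sum_k w k *: unsigned_Bt (enum_val k).

Lemma BH_weightedE H P l : BH P l H = weighted_BH (signed_weights P l H).
Proof.
rewrite /BH big_enum_val; apply: eq_bigr => k _.
by rewrite scalerA mulrC.
Qed.

Lemma unsigned_Bt_skew t : (unsigned_Bt t)^T = - unsigned_Bt t.
Proof. by rewrite linearB /= !trmx_mul !trmxK opprB. Qed.

Lemma weighted_BH_skew H (w : 'I_#|H| -> R) : (weighted_BH w)^T = - weighted_BH w.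
Proof.
rewrite linear_sum -sumrN; apply: eq_bigr => k _.
by rewrite linearZ /= unsigned_Bt_skew scalerN.
Qed.

Lemma weighted_BH_const H (w : 'I_#|H| -> R) x :
  weighted_BH w *m const_mx x = 0 :> 'cV_n.
Proof.
have diff0 i j : (evec R i - evec R j)^T *m const_mx x = 0 :> 'cV_1.
  by rewrite linearB mulmxBl /= !trmx_delta -!rowE !row_const subrr.
rewrite mulmx_suml big1 // => k _.
by rewrite -scalemxAl mulmxBl -!mulmxA !diff0 !mulmx0 subrr scaler0.
Qed.

Lemma weighted_BH_supp H (w : 'I_#|H| -> R) i j :
  j \notin vertices H -> weighted_BH w i j = 0.
Proof.
move=> jH; rewrite summxE big1 // => k _.
have: j \notin [set vtx1 (enum_val k); vtx2 (enum_val k); vtx3 (enum_val k)].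
  by apply: contra jH => jk; apply/bigcupP; exists (enum_val k); rewrite ?enum_valP.
rewrite !inE !negb_or => /andP[/andP[/negPf j1 /negPf j2] /negPf j3].
by rewrite !mxE !big_ord1 !mxE j1 j2 j3 !subrr !mulr0 subrr mulr0.
Qed.

(** Columns outside the vertex set of [H] are zero, and the terminal columns meet zero coordinates
    of [y]; only internal columns contribute. *)
Lemma weighted_BH_mul H (w : 'I_#|H| -> R) (I : {set 'I_n}) (a b : 'I_n)
    m (v : 'I_m -> 'I_n) (y : 'cV[R]_n) i :
  two_terminal H I a b -> injective v -> (v @: [set: 'I_m])%SET = I ->
  y a 0 = 0 -> y b 0 = 0 ->
  (weighted_BH w *m y) i 0 = \sum_k weighted_BH w i (v k) * y (v k) 0.
Proof.
move=> [_ VH _ _] v_inj vI ya yb.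
rewrite mxE (bigID (mem I)) /= [X in _ + X]big1 ?addr0 => [|j jI].
  rewrite -vI big_imset /=; last by move=> ? ? _ _ /v_inj.
  by apply: eq_bigl => k; rewrite inE.
have [jab|jab] := boolP (j \in [set a; b]).
  by move: jab; rewrite !inE => /orP[]/eqP->; rewrite ?ya ?yb mulr0.
by rewrite weighted_BH_supp ?mul0r // VH inE negb_or jI.
Qed.

Lemma terminals_eq (M : 'M[R]_n) (xi : 'cV[R]_n) rho a b :
  M^T = - M -> M *m xi = rho *: (evec R a - evec R b) -> rho != 0 ->
  xi a 0 = xi b 0.
Proof.
move=> Msk Mxi rho_neq0.
have dotE : (xi^T *m (evec R a - evec R b)) 0 0 = xi a 0 - xi b 0.
  by rewrite mulmxBr -!colE !mxE.
(* A 1x1 matrix is its own transpose, while skewness of [M] makes this one the opposite of its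
   transpose. *)
have quad0 : (xi^T *m (M *m xi)) 0 0 = 0.
  have /matrixP/(_ 0 0) : (xi^T *m (M *m xi))^T = - (xi^T *m (M *m xi)).
    by rewrite trmx_mul trmxK trmx_mul Msk mulmxN mulNmx mulmxA.
  by rewrite mxE [RHS]mxE; lra.
move: quad0; rewrite Mxi -scalemxAr mxE dotE => /eqP.
by rewrite mulf_eq0 (negPf rho_neq0) subr_eq0 => /eqP.
Qed.

Lemma weighted_BH_entry_form H i j :
  is_form 1 (fun w : 'I_#|H| -> R => weighted_BH w i j).
Proof.
have [p hp pE] : is_form 1 (fun w : 'I_#|H| -> R =>
    \sum_k unsigned_Bt (enum_val k) i j * w k).
  by apply: form_sum => k; apply: formZ; apply: form_var.
exists p => // w; rewrite -pE summxE; apply: eq_bigr => k _.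
by rewrite mxE mulrC.
Qed.

Lemma mxsub_skew m (v : 'I_m -> 'I_n) (M : 'M[R]_n) :
  M^T = - M -> (mxsub v v M)^T = - mxsub v v M.
Proof.
by move=> Msk; rewrite trmx_mxsub Msk; apply/matrixP => i j; rewrite !mxE.
Qed.

(** Degree 3 is 1 from the entry of the terminal block plus 2 from the 4x4 Pfaffian. *)
Lemma flux_form H (a b : 'I_n) (v : 'I_5 -> 'I_n) k :
  is_form 3 (fun w : 'I_#|H| -> R =>
    (terminal_block a b v (weighted_BH w) *m
     pf_vector (internal_block v (weighted_BH w))) k 0).
Proof.
pose kap (w : 'I_#|H| -> R) (j : 'I_5) :=
  let C x y := weighted_BH w (v (lift j x)) (v (lift j y)) in
  C ord0 (inord 1) * C (inord 2) (inord 3)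
  - C ord0 (inord 2) * C (inord 1) (inord 3)
  + C ord0 (inord 3) * C (inord 1) (inord 2).
have [p hp pE] : is_form 3 (fun w => \sum_j
    weighted_BH w (tnth [tuple a; b] k) (v j) * ((-1) ^+ j * kap w j)).
  apply: form_sum => j; apply: (@formM _ _ 1 2); first exact: weighted_BH_entry_form.
  apply: formZ; apply: formD; first apply: formB;
    by apply: (@formM _ _ 1 1); apply: weighted_BH_entry_form.
exists p => // w; rewrite -pE mxE; apply: eq_bigr => j _.
by rewrite pf_vectorE ?mxsub_skew ?weighted_BH_skew // !mxE.
Qed.
End Substress.

(* Kernel, flux and cubic dependence for the two-terminal substress *)
From mathcomp Require Import all_classical all_reals all_analysis.
Import Order.TTheory GRing.Theory Num.Theory.
Import numFieldNormedType.Exports.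
Local Open Scope classical_set_scope.
Local Open Scope ring_scope.

Theorem theorem7p3 (R : realType) (n : nat) (n_ge3 : (3 <= n)%N)
    (H : {set triple n}) (I : {set 'I_n}) (a b : 'I_n)
    (HI : two_terminal H I a b) (cardI : #|I| = 5%N)
    (v : 'I_5 -> 'I_n) (v_inj : injective v)
    (v_im : (v @: [set: 'I_5])%SET = I) :
  (forall (P : configuration R n) (q : multiplier R n),
     positive_area_local_optimum P -> KKT P q ->
     (forall t, t \in H -> 0 < lam q t) ->
     let M := BH P (lam q) H in
     let C := internal_block v M in
     let E := terminal_block a b v M in
     let kappa := pf_vector C in
     C *m kappa = 0 /\
     (\rank C = 4%N ->
        (forall x : 'cV[R]_5, C *m x = 0 <-> exists tau : R, x = tau *: kappa)
        /\
        (forall (xi : 'cV[R]_n) (rho : R),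
           shared_kernel P xi ->
           (forall i, i \in I -> (M *m xi) i 0 = 0) ->
           M *m xi = rho *: (evec R a - evec R b) ->
           rho != 0 ->
           xi a 0 = xi b 0 /\
           let w := xi - const_mx (xi a 0) in
           exists tau : R,
             rowsub v w = tau *: kappa /\
             rho *: (\col_(k < 2) [:: 1; -1]`_k) = tau *: (E *m kappa))))
  /\
  (exists p : 'I_2 -> mpoly.mpoly #|H| R,
     (forall k, homogeneous_of_degree 3 (p k)) /\
     (forall (P : configuration R n) (l : triple n -> R),
        let M := BH P l H in
        let C := internal_block v M in
        let E := terminal_block a b v M in
        forall k,
          (E *m pf_vector C) k 0 = mpoly.meval (signed_weights P l H) (p k))).
Proof.
split=> [P q _ _ _ M C E kappa|].
  have ME : M = weighted_BH (signed_weights P (lam q) H) by exact: BH_weightedE.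
  have Msk : M^T = - M by rewrite ME weighted_BH_skew.
  have Csk : C^T = - C by exact: mxsub_skew.
  split=> [|rankC]; first exact: mul_pf_vector.
  split=> [x|xi rho _ flux0 Mxi rho_neq0]; first exact: kernel_pf_vector.
  have xiab := terminals_eq Msk Mxi rho_neq0.
  split=> // w.
  have wa : w a 0 = 0 by rewrite !mxE subrr.
  have wb : w b 0 = 0 by rewrite !mxE xiab subrr.
  have Mw : M *m w = M *m xi by rewrite mulmxBr ME weighted_BH_const subr0.
  (* One identity serves both blocks: internal rows give the kernel equation, terminal rows give the
     flux. *)
  have blockE i : \sum_k M i (v k) * w (v k) 0 = (M *m xi) i 0.
    by rewrite -Mw ME (weighted_BH_mul _ _ HI v_inj v_im).
  have /(kernel_pf_vector _ Csk rankC)[tau wE] : C *m rowsub v w = 0.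
    apply/colP => i; rewrite [RHS]mxE -(flux0 (v i)); last first.
      by rewrite -v_im imset_f ?inE.
    by rewrite -blockE mxE; apply: eq_bigr => k _; rewrite !mxE.
  exists tau; split=> //; rewrite scalemxAr -wE; apply/colP => k.
  transitivity ((M *m xi) (tnth [tuple a; b] k) 0).
    case: HI => _ _ _ /negPf ab; rewrite Mxi !mxE.
    case: k => [[|[|//]] ltk];
      by rewrite /tnth /= !eqxx ?ab 1?eq_sym ?ab ?subr0 ?sub0r.
  by rewrite -blockE mxE; apply: eq_bigr => j _; rewrite !mxE.
(* The polynomials are chosen before [P] and [l], so they depend only on [H], the terminals and the
   ordering [v]. *)
have [p [p_homog pE]] := form_family (flux_form R H a b v).
exists p; split=> // P l M C E k.
by rewrite -pE /E /C /M BH_weightedE.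
Qed.
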